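(* Let $\mathcal{H}=(V,E)$ be a finite hypergraph, $\lambda>0$, and fix for each vertex $u$ a total order $<_u$ on the hyperedges containing $u$. For any $v\in V$, $\Lambda\subseteq V$ and $\sigma_\Lambda\in\{0,1\}^\Lambda$, we have $p_{\mathcal{H},v}^{\sigma_\Lambda}=P_{\mathcal{T}}^{\sigma_\Lambda}$, where $\mathcal{T}=\mathcal{T}_{\mathrm{SAW}}(\mathcal{H},v)$.
   Context: An independent set of a hypergraph is a vertex set meeting each hyperedge in at most one vertex; the Gibbs measure on a finite hypergraph has $\mu(I)\propto\lambda^{|I|}$. For a configuration $\sigma_\Lambda\in\{0,1\}^\Lambda$ on $\Lambda\subseteq V$, $p_{\mathcal{H},v}^{\sigma_\Lambda}=\Pr[v\in I\mid I\cap\Lambda=\sigma_\Lambda^{-1}(1)]$. A walk $(v_0,e_1,v_1,\dots,e_\ell,v_\ell)$ alternates vertices and hyperedges with $v_{i-1},v_i\in e_i$. It is self-avoiding if it is a simple path in the incidence graph (bipartite graph on $V\cup E$, $u\sim e$ iff $u\in e$) and for every $i=1,\dots,\ell$, $v_i$ belongs to none of $e_1,\dots,e_{i-1}$. A self-avoiding walk $w=(v_0,e_1,\dots,e_\ell,v_\ell)$ extends to a cycle-closing walk $(v_0,e_1,\dots,e_\ell,v_\ell,e',v')$ if for some $0\le i\le\ell-1$ the suffix $(v_i,e_{i+1},\dots,e_\ell,v_\ell,e',v')$ is a simple cycle in the incidence graph (so $v'=v_i$, $e'\notin\{e_1,\dots,e_\ell\}$); $v'$ is the cycle-closing vertex and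 $e_{i+1}$ the hyperedge starting the cycle. The self-avoiding walk tree $\mathcal{T}_{\mathrm{SAW}}(\mathcal{H},v)$ is the rooted hypertree built as follows: (1) its vertices are the self-avoiding walks in $\mathcal{H}$ starting at $v$, the root being $(v)$; (2) for a node $w$, the self-avoiding walks $(w,e',v')$ extending $w$ by one step are grouped by the hyperedge $e'$ used, and for each group a hyperedge of the tree consisting of $w$ together with the walks of that group is created; (3) every node $w=(v,e_1,v_1,\dots,e_\ell,v_\ell)$ that extends to a cycle-closing walk $(w,e',v')$ with $v'=v_i\in\{v,v_1,\dots,v_{\ell-1}\}$ and $e'<_{v_i}e_{i+1}$ is deleted together with all its descendants, and then hyperedges of size 1 are deleted. Each tree node is identified with the final vertex of its walk, so $\sigma_\Lambda$ translates into a configuration (still denoted $\sigma_\Lambda$) on the tree nodes whose final vertex lies in $\Lambda$. $P_{\mathcal{T}}^{\sigma_\Lambda}$ denotes the probability that the root of $\mathcal{T}$ is occupied under the Gibbs measure of $\mathcal{T}$ with activity $\lambda$ conditioned on this translated configuration. *)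

(* Defs.v *)
From HB Require Import structures.
From mathcomp Require Import all_boot all_order all_algebra.

Set Implicit Arguments.
Unset Strict Implicit.
Unset Printing Implicit Defensive.

Import Order.TTheory GRing.Theory Num.Theory.
Local Open Scope ring_scope.

(* A finite hypergraph is a finType V of vertices with a set E : {set {set V}}
   of hyperedges. *)

Section Gibbs.
Variables (R : realFieldType) (V : finType) (E : {set {set V}}) (lambda : R).

Definition independent (I : {set V}) : bool :=
  [forall e in E, #|I :&: e| <= 1]%N.

Definition partition_function : R :=
  \sum_(I : {set V} | independent I) lambda ^+ #|I|.

Definition gibbs (I : {set V}) : R :=
  if independent I then lambda ^+ #|I| / partition_function else 0.

Definition Pr (A : pred {set V}) : R := \sum_(I : {set V} | A I) gibbs I.

(* Conditional probability; it is 0 by convention when Pr B = 0. *)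
Definition condPr (A B : pred {set V}) : R := Pr (predI A B) / Pr B.

(* A configuration on L is represented by a function on all of V; its values
   outside L are never used. *)
Definition agrees (L : {set V}) (sigma : V -> bool) : pred {set V} :=
  fun I => I :&: L == [set u in L | sigma u].

Definition marginal (L : {set V}) (sigma : V -> bool) (v : V) : R :=
  condPr (fun I => v \in I) (agrees L sigma).

End Gibbs.

Record strict_total_order_on (T : finType) (D : {set T}) (lt : rel T) : Prop :=
  StrictTotalOrderOn {
    sto_irr : {in D, irreflexive lt};
    sto_trans : {in D & &, transitive lt};
    sto_total : {in D &, forall x y, x != y -> lt x y || lt y x} }.

Section Walks.
Variables (V : finType) (E : {set {set V}}).

Definition incidence : rel (V + {set V}) := fun x y =>
  match x, y with
  | inl u, inr e | inr e, inl u => (e \in E) && (u \in e)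
  | _, _ => false
  end.

(* The walk (v_0, e_1, v_1, ..., e_l, v_l) is given by its initial vertex v_0
   and the sequence w = [:: (e_1, v_1); ...; (e_l, v_l)]. *)
Implicit Types (u : V) (w : seq ({set V} * V)).

Definition incidence_seq u w : seq (V + {set V}) :=
  inl u :: flatten [seq [:: inr s.1; inl s.2] | s <- w].

Definition walk_vertex u w (i : nat) : V := nth u (u :: unzip2 w) i.

(* The hyperedge e_(i+1). *)
Definition walk_edge w (i : nat) : {set V} := nth set0 (unzip1 w) i.

Definition walk_end u w : V := last u (unzip2 w).

(* The last conjunct says that v_j is not in e_i whenever 1 <= i < j. *)
Definition self_avoiding u w : bool :=
  [&& sorted incidence (incidence_seq u w), uniq (incidence_seq u w)
    & pairwise (fun s t : {set V} * V => t.2 \notin s.1) w].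

(* The suffix (v_i, e_(i+1), v_(i+1), ..., e_l, v_l, e', v_i) is a simple cycle
   of the incidence graph; the repeated final vertex is left out, as usual for
   [cycle]. *)
Definition closes_cycle u w (i : nat) (e' : {set V}) : bool :=
  (i < size w)%N
  && ucycleb incidence
       (rcons (incidence_seq (walk_vertex u w i) (drop i w)) (inr e')).

Lemma mem_incidence_seq u w x :
  (inl x \in incidence_seq u w) = (x \in u :: unzip2 w).
Proof.
rewrite /incidence_seq !inE; congr (_ || _).
by elim: w => //= s w IH; rewrite !inE /= IH.
Qed.

Lemma uniq_walk_vertices u w :
  uniq (incidence_seq u w) -> uniq (u :: unzip2 w).
Proof.
elim: w u => //= s w IH u /andP[Hu /andP[_ Hw]].
have /= -> := IH s.2 Hw; rewrite andbT.
apply: contra Hu => Hu; rewrite !inE /=.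
by have /= := mem_incidence_seq s.2 w u; rewrite !inE /= => ->; rewrite -in_cons.
Qed.

(* Hence self-avoiding walks can be taken in the finType of sequences of at
   most #|V| steps. *)
Lemma self_avoiding_size u w : self_avoiding u w -> (size w < #|V|)%N.
Proof.
case/and3P=> _ /uniq_walk_vertices Hu _.
by have := max_card [in u :: unzip2 w]; rewrite (card_uniqP Hu) /= size_map.
Qed.

End Walks.

Section SAWTree.
Variables (V : finType) (E : {set {set V}}) (ltE : V -> rel {set V}) (v : V).

Definition walk_type : finType := #|V|.-bseq ({set V} * V)%type.

Definition saw : finType := {w : walk_type | self_avoiding E v w}.

Definition saw_seq (w : saw) : seq ({set V} * V) := val w.

Definition saw_extensions (w : saw) (e : {set V}) : {set saw} :=
  [set x : saw | [exists u : V, saw_seq x == rcons (saw_seq w) (e, u)]].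

Definition saw_hyperedges : {set {set saw}} :=
  [set w |: saw_extensions w e | w in [set: saw], e in E
                               & saw_extensions w e != set0].

Definition violating (w : saw) : bool :=
  [exists e' : {set V}, [exists i : 'I_(size (saw_seq w)),
     closes_cycle E v (saw_seq w) i e'
     && ltE (walk_vertex v (saw_seq w) i) e' (walk_edge (saw_seq w) i)]].

(* Descendants of a node are the walks having it as a prefix. *)
Definition deleted (w : saw) : bool :=
  [exists x : saw, prefix (saw_seq x) (saw_seq w) && violating x].

(* T_SAW(H, v) has vertex type tree_node and hyperedges tree_hyperedges: the
   hyperedges of the undeleted tree are traced on the remaining nodes, and those
   with at most one node left (none, if the parent was deleted) are dropped. *)
Definition tree_node : finType := {w : saw | ~~ deleted w}.

Definition tree_hyperedges : {set {set tree_node}} :=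
  [set f in [set [set x : tree_node | val x \in e] | e : {set saw} in saw_hyperedges]
     | (1 < #|f|)%N].

Definition node_vertex (x : tree_node) : V := walk_end v (saw_seq (val x)).

Lemma root_self_avoiding : self_avoiding E v ([bseq] : walk_type).
Proof. by []. Qed.

Definition saw_root : saw := Sub [bseq] root_self_avoiding.

Lemma root_not_deleted : ~~ deleted saw_root.
Proof.
apply/existsPn => x; rewrite prefixs0; apply/negP=> /andP[/eqP Hx].
by case/existsP=> e' /existsP[[i /= Hi]] _; rewrite Hx in Hi.
Qed.

Definition tree_root : tree_node := Sub saw_root root_not_deleted.

End SAWTree.

Section Feasibility.
Variables (R : realFieldType) (V : finType) (E : {set {set V}}) (lambda : R).
Hypothesis lambda_gt0 : 0 < lambda.

Lemma independent_sub (I J : {set V}) :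
  J \subset I -> independent E I -> independent E J.
Proof.
move=> JI /forall_inP HI; apply/forall_inP=> e /HI; apply: leq_trans.
by rewrite subset_leq_card // setSI.
Qed.

Lemma partition_function_gt0 : 0 < partition_function E lambda.
Proof.
have Hi0 : independent E set0.
  by apply/forall_inP=> e _; rewrite set0I cards0.
rewrite /partition_function (bigD1 set0) //= cards0 expr0.
by rewrite ltr_pwDl // sumr_ge0 // => I _; rewrite exprn_ge0 // ltW.
Qed.

Lemma gibbs_ge0 (I : {set V}) : 0 <= gibbs E lambda I.
Proof.
rewrite /gibbs; case: ifP => // _.
by rewrite divr_ge0 ?exprn_ge0 ?ltW // partition_function_gt0.
Qed.

Lemma Pr_agrees_gt0 (L : {set V}) (sigma : V -> bool) :
  (0 < Pr E lambda (agrees L sigma)) = independent E [set u in L | sigma u].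
Proof.
apply/idP/idP=> [|Hind].
  apply: contraTT => Hnind; rewrite -leNgt /Pr big1 // => I /eqP HI.
  rewrite /gibbs ifN //; apply: contra Hnind => /independent_sub; apply.
  by rewrite -HI subsetIl.
rewrite /Pr (bigD1 [set u in L | sigma u]) /=; last first.
  by apply/eqP/setP=> u; rewrite !inE; case: (u \in L); rewrite ?andbF ?andbT.
rewrite ltr_pwDl ?sumr_ge0 // => [|I _]; last exact: gibbs_ge0.
by rewrite /gibbs Hind divr_gt0 ?exprn_gt0 ?partition_function_gt0.
Qed.

End Feasibility.

(* If the configuration sigma on L has positive probability in H, then so does
   its translation to T_SAW(H, v): conditioning on it is meaningful. *)
Lemma tree_Pr_agrees_gt0 (R : realFieldType) (V : finType) (E : {set {set V}})
    (lambda : R) (ltE : V -> rel {set V}) (v : V) (L : {set V})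
    (sigma : V -> bool) :
  0 < lambda -> 0 < Pr E lambda (agrees L sigma) ->
  0 < Pr (tree_hyperedges E ltE v) lambda
        (agrees [set x | node_vertex x \in L] (fun x => sigma (node_vertex x))).
Proof.
move=> l0; rewrite !Pr_agrees_gt0 // => /forall_inP Hind.
apply/forall_inP=> f; rewrite inE => /andP[/imsetP[e0 He0 ->] _].
case/imset2P: He0 => w e _; rewrite inE => /andP[eE Hne] ->{e0 f}.
have ext (x : saw E v) u : saw_seq x = rcons (saw_seq w) (e, u) ->
    [/\ walk_end v (saw_seq w) \in e, u \in e
      & walk_end v (saw_seq w) != u].
  move=> Hx; have /and3P[] := valP x; rewrite -/(saw_seq x) Hx => Hp Hu _.
  have ne : walk_end v (saw_seq w) != u.
    apply: contraTneq (uniq_walk_vertices Hu); rewrite /walk_end => <-.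
    by rewrite /unzip2 map_rcons -rcons_cons rcons_uniq /= mem_last.
  move: Hp; rewrite /incidence_seq map_rcons -cats1 flatten_cat /=.
  rewrite cat_path => /andP[_].
  have -> : last (inl v) (flatten [seq [:: inr s.1; inl s.2] | s <- saw_seq w])
      = inl (walk_end v (saw_seq w)) :> V + {set V}.
    by rewrite /walk_end; move: (saw_seq w) => t; elim: t (v) => //= s t IH _.
  by case/and3P=> /andP[_ we] /andP[_ ue] _.
have we : walk_end v (saw_seq w) \in e.
  by have [x] := set0Pn _ Hne; rewrite inE => /existsP[u /eqP/ext[]].
have /card_le1_eqP He := Hind e eE.
apply/card_le1_eqP=> x y.
have key z : z \in [set x in [set x : tree_node E ltE v | node_vertex x \in L]
                   | sigma (node_vertex x)] ->
    node_vertex z \in e -> node_vertex z \in [set u in L | sigma u] :&: e.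
  by rewrite !inE => -> ->.
have cases (z : tree_node E ltE v) : val z \in w |: saw_extensions w e ->
    val z = w \/ saw_seq (val z) = rcons (saw_seq w) (e, node_vertex z).
  case/setU1P=> [->|]; first by left.
  rewrite inE => /existsP[u /eqP Hz]; right.
  by rewrite /node_vertex /walk_end Hz /unzip2 map_rcons last_rcons.
have inj (z t : tree_node E ltE v) : saw_seq (val z) = saw_seq (val t) -> z = t.
  by move/val_inj/val_inj/val_inj.
rewrite !in_setI => /andP[xJ]; rewrite [in X in X -> _]inE => /cases xf.
case/andP=> [yJ]; rewrite [in X in X -> _]inE => /cases yf.
have vin (z : tree_node E ltE v) : val z = w \/ saw_seq (val z) = rcons (saw_seq w) (e, node_vertex z) ->
    node_vertex z \in e.
  by case=> [Hz|/ext[]//]; rewrite /node_vertex Hz.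
have xy : node_vertex x = node_vertex y.
  by apply: He; apply: key => //; exact: vin.
case: xf yf => [xw|xf] [yw|yf].
- by apply: inj; rewrite xw yw.
- by have [_ _] := ext _ _ yf; rewrite -xy /node_vertex xw eqxx.
- by have [_ _] := ext _ _ xf; rewrite xy /node_vertex yw eqxx.
- by apply: inj; rewrite xf yf xy.
Qed.

(* Main.v *)
Require Import Defs.
From mathcomp Require Import all_boot all_order all_algebra.

(* The hypergraph and its tree satisfy one and the same recursion. Deleting
   vertices is the only operation needed: an edge with at most one active vertex
   imposes no constraint. If the edges at an active vertex [v] are
   [e_1, ..., e_d], the odds of [v] being occupied in the active set [A] are
   [lambda * \prod_k 1 / (1 + \sum_(u in e_k) odds_k u)], where [odds_k u] is
   computed after deletion of [v], of [e_1, ..., e_(k-1)], and of the vertices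
   of [e_k] other than [u]: reveal one after the other that [e_1, ..., e_d] are
   free of occupied vertices. In the hypergraph, with the edges at each vertex
   in the given order, the active set reached along a walk depends only on the
   walk, and the next vertices it allows are exactly those of the children kept
   in the tree. In the tree, the recursion in the corresponding order of the
   child edges only ever deletes vertices outside the current branch. *)

Set Implicit Arguments.
Unset Strict Implicit.
Unset Printing Implicit Defensive.

Import Order.TTheory GRing.Theory Num.Theory.
Local Open Scope ring_scope.

(** * Odds of occupation in an induced subhypergraph *)

Section ActiveSet.
Variables (R : realFieldType) (V : finType) (E : {set {set V}}) (lambda : R).
Variables (L : {set V}) (sigma : V -> bool).
Implicit Types (A B I e : {set V}) (s : seq {set V}) (u v : V).

Definition pinned u : bool := (u \in L) && sigma u.

(* Vertices outside [A] are deleted, even when [sigma] makes them occupied. *)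
Definition config A I : bool :=
  [&& I \subset A, independent E I
    & [forall u in A, (u \in L) ==> ((u \in I) == sigma u)]].

Definition weight A (P : pred {set V}) : R :=
  \sum_(I : {set V} | config A I && P I) lambda ^+ #|I|.

Definition avoiding A B : R := weight A (fun I => [disjoint I & B]).

Definition occupied A u : R := weight A (fun I => u \in I).

Definition odds A u : R := occupied A u / avoiding A [set u].

(* A vertex that [sigma] makes occupied has infinite odds, which [odds] does not
   show since division by zero gives [0]; hence the separate case. *)
Definition edge_factor A e : R :=
  if [exists u in e :&: A, pinned u] then 0
  else (1 + \sum_(u in e :&: A) odds (A :\: (e :\ u)) u)^-1.

Fixpoint edge_factors A s : R :=
  if s is e :: s' then edge_factor A e * edge_factors (A :\: e) s' else 1.

Definition cover_seq s : {set V} := \bigcup_(e <- s) e.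

Lemma eq_weight A (P Q : pred {set V}) :
  (forall I, config A I -> P I = Q I) -> weight A P = weight A Q.
Proof.
by move=> PQ; apply: eq_bigl => I; case: (boolP (config A I)) => //= /PQ.
Qed.

Lemma avoiding0 A : avoiding A set0 = weight A xpredT.
Proof.
by apply: eq_weight => I _; rewrite disjoint_sym disjoints_subset sub0set.
Qed.

(** Configurations on [A] that are empty on [B1] are the configurations on [A :\: B1], provided the
    deletion forgets no vertex that [sigma] makes occupied. *)
Lemma avoidingU A B1 B2 :
  ~~ [exists u in B1 :&: A, pinned u] ->
  avoiding A (B1 :|: B2) = avoiding (A :\: B1) B2.
Proof.
move=> nB; apply: eq_bigl => I.
have dU : [disjoint I & B1 :|: B2] = [disjoint I & B1] && [disjoint I & B2].
  by rewrite -!setI_eq0 setIUr setU_eq0.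
rewrite dU /config subsetD; case: (I \subset A) => //=.
case: (boolP [disjoint I & B1]) => dI; rewrite /= ?andbF // ?andbT.
case: independent => //=; congr (_ && _).
apply/forall_inP/forall_inP => H u.
  by rewrite inE => /andP[_]; exact: H.
move=> uA; case: (boolP (u \in B1)) => uB; last by apply: H; rewrite inE uB.
apply/implyP=> uL; rewrite (disjointFl dI uB) eq_sym eqbF_neg.
by apply: contra nB => su; apply/exists_inP; exists u;
  rewrite ?inE ?uB // /pinned uL.
Qed.

Lemma avoiding_pinned A B :
  [exists u in B :&: A, pinned u] -> avoiding A B = 0.
Proof.
case/exists_inP=> u; rewrite inE => /andP[uB uA] /andP[uL su].
rewrite /avoiding /weight big1 // => I /andP[/and3P[_ _ /forall_inP/(_ u uA)]].
by rewrite uL su /= => /eqP uI dI; rewrite (disjointFr dI uI) in uB.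
Qed.

(** Occupation of [u] empties the rest of [e], which can then be deleted. The first hypothesis
    replaces [e \in E] so as to allow also sets of at most one vertex. *)
Lemma occupied_setD A e u :
  (forall I, config A I -> #|I :&: e| <= 1)%N -> u \in e ->
  ~~ [exists u in e :&: A, pinned u] ->
  occupied A u = occupied (A :\: (e :\ u)) u.
Proof.
move=> He ue nP; apply: eq_bigl => I.
case: (boolP (u \in I)) => uI; rewrite ?andbF // !andbT.
apply/idP/idP=> HI.
  have dI : [disjoint I & e :\ u].
    rewrite disjoint_subset; apply/subsetP=> y yI; rewrite !inE negb_and negbK.
    case: (boolP (y \in e)) => ye; rewrite ?orbT // orbF.
    by have /card_le1_eqP H1 := He I HI; apply/eqP/H1; rewrite inE ?uI ?yI.
  case/and3P: HI => IA Ii /forall_inP H; apply/and3P; split => //.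
    by rewrite subsetD IA.
  by apply/forall_inP=> y; rewrite inE => /andP[_ /H].
case/and3P: HI; rewrite subsetD => /andP[IA dI] Ii /forall_inP H.
apply/and3P; split => //; apply/forall_inP=> y yA.
case: (boolP (y \in e :\ u)) => yu; last by apply: H; rewrite inE yu.
apply/implyP=> yL; rewrite (disjointFl dI yu) eq_sym eqbF_neg.
apply: contra nP => sy; apply/exists_inP; exists y; rewrite ?inE /pinned ?yL //.
by rewrite yA; case/setD1P: yu => _ ->.
Qed.

(** Splits the configurations according to the occupied vertex of [e], of which there is at most
    one. *)
Lemma weight_edge A e :
  (forall I, config A I -> #|I :&: e| <= 1)%N ->
  weight A xpredT = avoiding A e + \sum_(u in e :&: A) occupied A u.
Proof.
move=> He; rewrite /avoiding /occupied /weight.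
rewrite (bigID (fun I => [disjoint I & e])) /=; congr (_ + _).
  by apply: eq_bigl => I; rewrite andbT.
rewrite (exchange_big_dep (config A)) /=; last by move=> u I _ /andP[].
rewrite [RHS](bigID (fun I => [disjoint I & e])) /= [X in _ = X + _]big1 ?add0r.
  apply: eq_big => [I|I]; first by rewrite andbT.
  rewrite andbT => /andP[HI]; rewrite -setI_eq0 => /set0Pn[u].
  rewrite inE => /andP[uI ue].
  have uA : u \in A by case/and3P: HI => /subsetP/(_ u uI).
  rewrite (big_pred1 u) // => y; rewrite !inE HI /=.
  apply/andP/eqP => [[/andP[ye yA] yI]|->]; last by rewrite ue uA.
  by have /card_le1_eqP := He I HI; apply; rewrite inE ?uI ?yI.
move=> I /andP[HI dI]; rewrite big1 // => u /andP[]; rewrite inE => /andP[ue _].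
by case/andP=> _ uI; rewrite (disjointFr dI uI) in ue.
Qed.

Hypothesis lambda_gt0 : 0 < lambda.
Hypothesis pinned_independent : independent E [set u in L | sigma u].

Lemma weight_ge0 A P : 0 <= weight A P.
Proof. by apply: sumr_ge0 => I _; rewrite exprn_ge0 // ltW. Qed.

Lemma avoiding_gt0 A B :
  ~~ [exists u in B :&: A, pinned u] -> 0 < avoiding A B.
Proof.
(* Witness: exactly the active pinned vertices are occupied. *)
move=> nP; rewrite /avoiding /weight (bigD1 (A :&: [set u in L | sigma u])) /=.
  rewrite ltr_pwDl ?exprn_gt0 //.
  by apply: sumr_ge0 => I _; rewrite exprn_ge0 // ltW.
apply/andP; split; last first.
  rewrite disjoint_subset; apply/subsetP=> u; rewrite !inE => /andP[uA pu].
  by apply: contra nP => uB; apply/exists_inP; exists u; rewrite // inE uB.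
apply/and3P; split; first exact: subsetIl.
  exact: independent_sub (subsetIr _ _) pinned_independent.
by apply/forall_inP=> u uA; apply/implyP=> uL; rewrite !inE uA uL.
Qed.

Lemma weight_gt0 A : 0 < weight A xpredT.
Proof.
rewrite -avoiding0.
by apply: avoiding_gt0; apply/exists_inP=> -[u]; rewrite set0I inE.
Qed.

(** [edge_factor A e] is the probability that [e] has no occupied vertex: dividing [weight_edge] by
    [avoiding A e] turns each summand into odds. *)
Lemma avoiding_edge A e :
  (forall I, config A I -> #|I :&: e| <= 1)%N ->
  avoiding A e = weight A xpredT * edge_factor A e.
Proof.
move=> He; rewrite /edge_factor; case: ifPn => [/avoiding_pinned->|nP].
  by rewrite mulr0.
have W0 := avoiding_gt0 nP.
have -> : weight A xpredT
    = avoiding A e * (1 + \sum_(u in e :&: A) odds (A :\: (e :\ u)) u).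
  rewrite (weight_edge He) mulrDr mulr1; congr (_ + _); rewrite mulr_sumr.
  apply: eq_bigr => u; rewrite inE => /andP[ue uA].
  (* Avoiding [e] is avoiding [e :\ u], then [u]; once [e :\ u] is deleted, this is the denominator
     of the odds of [u]. *)
  rewrite /odds -avoidingU; last first.
    apply: contra nP => /exists_inP[y];
      rewrite !inE => /andP[/andP[_ ye] yA] py.
    by apply/exists_inP; exists y; rewrite // inE ye.
  rewrite setUC setD1K // -occupied_setD // mulrC divfK //.
  by rewrite lt0r_neq0.
rewrite mulfK // lt0r_neq0 // ltr_pwDl //; apply: sumr_ge0 => u _.
by rewrite divr_ge0 // weight_ge0.
Qed.

Lemma config_setD A B I :
  ~~ [exists u in B :&: A, pinned u] -> config (A :\: B) I -> config A I.
Proof.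
move=> nP /and3P[]; rewrite subsetD => /andP[IA dI] Ii /forall_inP H.
apply/and3P; split => //; apply/forall_inP=> y yA.
case: (boolP (y \in B)) => yB; last by apply: H; rewrite inE yB.
apply/implyP=> yL; rewrite (disjointFl dI yB) eq_sym eqbF_neg.
by apply: contra nP => sy; apply/exists_inP; exists y;
  rewrite ?inE /pinned ?yL // yB.
Qed.

(** Chain rule: the edges of [s] are revealed to be free one after the other, each being deleted
    before the next is considered. *)
Lemma avoiding_cover A s :
  (forall e, e \in s -> forall I, config A I -> #|I :&: e| <= 1)%N ->
  avoiding A (cover_seq s) = weight A xpredT * edge_factors A s.
Proof.
elim: s A => [|e s IH] A He /=.
  by rewrite mulr1 /cover_seq big_nil avoiding0.
rewrite mulrA -avoiding_edge; last by apply: He; rewrite mem_head.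
rewrite /cover_seq big_cons -/(cover_seq s).
have [pe|nP] := boolP [exists u in e :&: A, pinned u].
  rewrite !avoiding_pinned ?mul0r //.
  case/exists_inP: pe => u; rewrite inE => /andP[ue uA] pu.
  by apply/exists_inP; exists u; rewrite // !inE ue.
rewrite avoidingU // IH => [|e' e's I /(config_setD nP)]; last first.
  by apply: He; rewrite inE e's orbT.
congr (_ * _); by rewrite -avoiding0 -avoidingU // setU0.
Qed.

(** Adding [v] is a bijection from the configurations that avoid the neighbours of [v] to those that
    contain [v]. Only active neighbours matter, so [B] may be arbitrary outside [A]. *)
Lemma occupied_vertex A v B :
  v \in A -> v \notin L ->
  (forall u, u \in A -> u != v ->
     (u \in B) = [exists e in E, (u \in e) && (v \in e)]) ->
  occupied A v = lambda * avoiding (A :\ v) B.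
Proof.
move=> vA vL HB; rewrite /occupied /avoiding /weight mulr_sumr.
rewrite (reindex_onto (fun I => v |: I) (fun I => I :\ v)) /=; last first.
  by move=> I /andP[_ vI]; rewrite setD1K.
apply: eq_big => [I|I /andP[_ /eqP HI]]; last first.
  rewrite -exprS cardsU1 (_ : v \notin I) //.
  by rewrite -HI !inE eqxx.
rewrite setU11 andbT.
(* For [I] containing [v] both sides fail: [I] differs from [(v |: I) :\ v] and is not contained in
   [A :\ v]. *)
case: (boolP (v \in I)) => vI.
  have -> : ((v |: I) :\ v == I) = false.
    by apply/eqP=> HI; move: vI; rewrite -HI !inE eqxx.
  rewrite andbF; apply/esym/negP=> /andP[/and3P[/subsetP/(_ v vI)]].
  by rewrite !inE eqxx.
rewrite setU1K // eqxx andbT /config subUset sub1set vA subsetD1 vI andbT /=.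
case: (boolP (I \subset A)) => //= IA.
have uN u : u \in I -> u != v by apply: contraTneq => ->.
have -> : [forall u in A, (u \in L) ==> ((u \in v |: I) == sigma u)]
  = [forall u in A :\ v, (u \in L) ==> ((u \in I) == sigma u)].
  apply/forall_inP/forall_inP => H u.
    by move/setD1P=> [uv /H]; rewrite !inE (negbTE uv).
  move=> uA; have [->|uv] := eqVneq u v; first by rewrite (negbTE vL).
  by rewrite !inE (negbTE uv); apply: H; rewrite !inE uv.
rewrite andbAC [independent E I && _]andbC; congr (_ && _).
apply/forall_inP/andP=> [H|[dI /forall_inP H] e eE].
  split; last by apply: (@independent_sub _ _ (v |: I));
    [exact: subsetUr|exact/forall_inP].
  rewrite disjoint_subset; apply/subsetP=> u uI;
    rewrite inE HB ?(subsetP IA) ?uN //.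
  apply/exists_inP=> -[e /H/card_le1_eqP He /andP[ue ve]].
  by have := uN u uI; rewrite (He u v) ?eqxx // !inE ?uI ?orbT ?eqxx.
case: (boolP (v \in e)) => ve; last first.
  rewrite (_ : _ :&: e = I :&: e) ?H //; apply/setP=> u; rewrite !inE.
  by have [->|//] := eqVneq u v; rewrite (negbTE ve) !andbF.
rewrite (_ : _ :&: e = [set v]) ?cards1 //; apply/setP=> u; rewrite !inE.
have [->|uv] //= := eqVneq u v; apply/negP=> /andP[uI ue].
have := disjointFr dI uI; rewrite HB ?(subsetP IA) // => /negbT/negP; apply.
by apply/exists_inP; exists e; rewrite ?ue.
Qed.

Lemma odds_pinned0 A v : v \in A -> v \in L -> ~~ sigma v -> odds A v = 0.
Proof.
move=> vA vL nv; rewrite /odds /occupied /weight big1 ?mul0r // => I.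
by case/andP=> /and3P[_ _ /forall_inP/(_ v vA)];
  rewrite vL (negbTE nv) => /eqP->.
Qed.

(** The order of [s] is free, and its union matters only on active vertices other than [v]. In the
    tree, this allows omitting the parent edge of a node once its other nodes are deleted, and
    including child edges reduced to one node. *)
Lemma odds_rec A v s :
  v \in A -> v \notin L ->
  (forall e, e \in s -> e \in E \/ #|e| <= 1)%N ->
  (forall u, u \in A -> u != v ->
     (u \in cover_seq s) = [exists e in E, (u \in e) && (v \in e)]) ->
  odds A v = lambda * edge_factors (A :\ v) s.
Proof.
move=> vA vL He HB.
have nP : ~~ [exists u in [set v] :&: A, pinned u].
  apply/exists_inP=> -[u]; rewrite !inE => /andP[/eqP-> _].
  by rewrite /pinned (negbTE vL).
rewrite /odds (occupied_vertex vA vL HB) avoiding_cover; last first.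
  move=> e /He[eE|e1] I /and3P[_ /forall_inP Hi _]; first exact: Hi.
  by apply: leq_trans e1; rewrite subset_leq_card // subsetIr.
have -> : avoiding A [set v] = weight (A :\ v) xpredT.
  by rewrite -avoiding0 -avoidingU // setU0.
by rewrite -mulrA [_ * edge_factors _ _]mulrC mulfK // lt0r_neq0 // weight_gt0.
Qed.

Lemma marginal_odds v :
  marginal E lambda L sigma v
  = if pinned v then 1 else odds [set: V] v / (1 + odds [set: V] v).
Proof.
have Z0 := partition_function_gt0 E lambda_gt0.
have PrE (P : pred {set V}) : Pr E lambda (predI P (agrees L sigma))
    = weight [set: V] P / partition_function E lambda.
  rewrite /weight mulr_suml.
  rewrite [RHS](eq_bigl (fun I =>
    predI P (agrees L sigma) I && independent E I)).
    by rewrite big_mkcondr /=; apply: eq_bigr => I _; rewrite /gibbs.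
  move=> I; rewrite /config subsetT /= andbC [RHS]andbAC -andbA; congr (_ && _).
  congr (_ && _).
  apply/forall_inP/eqP => [H|H u _].
    apply/setP=> u; rewrite !inE; case: (boolP (u \in L)) => uL;
      rewrite ?andbF //=.
    by have := H u (in_setT u); rewrite uL => /eqP->; rewrite andbT.
  by apply/implyP=> uL; move/setP/(_ u): H; rewrite !inE uL andbT => ->.
have -> : marginal E lambda L sigma v
    = occupied [set: V] v / weight [set: V] xpredT.
  rewrite /marginal /condPr PrE.
  have -> : Pr E lambda (agrees L sigma)
    = Pr E lambda (predI xpredT (agrees L sigma)) by [].
  by rewrite PrE -mulf_div divff ?mulr1 // invr_eq0 lt0r_neq0.
(* This is [weight_edge] for the singleton of [v], which need not be an edge. *)
have -> : weight [set: V] xpredT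
    = avoiding [set: V] [set v] + occupied [set: V] v.
  rewrite (@weight_edge _ [set v]) ?setIT ?big_set1 // => I _.
  by rewrite -(cards1 v) subset_leq_card // subsetIr.
have [pv|nv] := boolP (pinned v).
  have pe : [exists u in [set v] :&: [set: V], pinned u].
    by apply/exists_inP; exists v; rewrite // !inE eqxx.
  have := weight_gt0 [set: V].
  rewrite (@weight_edge _ [set v]) ?setIT ?big_set1 //; last first.
    by move=> I _; rewrite -(cards1 v) subset_leq_card // subsetIr.
  by rewrite (avoiding_pinned pe) add0r => o0; rewrite divff // lt0r_neq0.
have a0 : 0 < avoiding [set: V] [set v].
  apply: avoiding_gt0; apply/exists_inP=> -[u]; rewrite !inE andbT => /eqP->.
  exact/negP.
have an := lt0r_neq0 a0.
rewrite /odds -[X in X + _ / _](divff an) -mulrDl -mulf_div divff ?mulr1 //.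
by rewrite invr_eq0.
Qed.

End ActiveSet.

Lemma pairwise_enumeration (T : finType) (D : {set T}) (lt : rel T) :
  strict_total_order_on D lt -> exists2 s, s =i D & pairwise lt s.
Proof.
(* Sorting uses the reflexive closure; strictness is recovered from the absence of duplicates. *)
move=> [irr tr tot]; pose le := [rel x y | (x == y) || lt x y].
have Ps : all [in D] (enum D) by apply/allP=> x; rewrite mem_enum.
exists (sort le (enum D)) => [x|]; first by rewrite mem_sort mem_enum.
have Ds : all [in D] (sort le (enum D)) by rewrite all_sort.
have tot' : {in D &, total le}.
  move=> x y xD yD /=; have [//|xy] := eqVneq x y.
  by rewrite orFb; have := tot x y xD yD xy.
have tr' : {in D & &, transitive le}.
  move=> y x z yD xD zD /= /predU1P[->//|xy] /predU1P[<-|yz].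
    by rewrite xy orbT.
  by rewrite (tr y x z) ?orbT.
have := sort_sorted_in tot' Ps.
rewrite (sorted_pairwise_in tr' Ds).
have := sort_uniq le (enum D); rewrite enum_uniq.
elim: (sort le (enum D)) => //= x s IH /andP[xs us] /andP[/allP xle sle].
rewrite IH // andbT; apply/allP=> y ys.
by case/predU1P: (xle y ys) => // xy; rewrite xy ys in xs.
Qed.

(** * One-step extensions of walks *)

Section Extension.
Variables (V : finType) (E : {set {set V}}) (ltE : V -> rel {set V}).
Hypothesis ltE_order : forall u : V,
  strict_total_order_on [set e in E | u \in e] (ltE u).
Implicit Types (x y u : V) (e f : {set V}) (w : seq ({set V} * V)).

Definition covered_before x e y : bool :=
  [exists e' in E, [&& x \in e', ltE x e' e & y \in e']].

(** Survival of [y] under the deletions made along the walk. Visited vertices need no clause of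
    their own: each vertex of a nonempty walk, its end included, lies on an edge of the walk. *)
Fixpoint unblocked x w y : bool :=
  if w is (e, u) :: w' then
    [&& y \notin e, ~~ covered_before x e y & unblocked u w' y]
  else true.

Lemma unblocked_rcons x w e u y :
  unblocked x (rcons w (e, u)) y
  = [&& unblocked x w y, y \notin e & ~~ covered_before (walk_end x w) e y].
Proof.
by elim: w x => [|[f z] w IH] x /=; rewrite ?andbT // IH -!andbA.
Qed.

Lemma unblocked_edges x w y :
  unblocked x w y -> all (fun s : {set V} * V => y \notin s.1) w.
Proof. by elim: w x => //= -[e u] w IH x /and3P[-> _ /IH]. Qed.

Lemma incidence_seq_rcons x w e u :
  incidence_seq x (rcons w (e, u)) = incidence_seq x w ++ [:: inr e; inl u].
Proof. by rewrite /incidence_seq map_rcons -cats1 flatten_cat. Qed.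

Lemma last_incidence_seq x w z :
  last z (incidence_seq x w) = inl (walk_end x w).
Proof. by rewrite /walk_end /=; elim: w x => //= -[e u] w IH x; apply: IH. Qed.

Lemma mem_edge_incidence_seq x w e :
  (inr e \in incidence_seq x w) = (e \in unzip1 w).
Proof.
rewrite /incidence_seq inE /=.
by elim: w => //= s w IH; rewrite !inE /= IH.
Qed.

Lemma walk_vertex_in_edge x w y :
  sorted (incidence E) (incidence_seq x w) -> y \in x :: unzip2 w ->
  y != walk_end x w -> has (fun s : {set V} * V => y \in s.1) w.
Proof.
elim: w x => [|[e u] w IH] x /=; first by rewrite inE => _ /eqP->; rewrite eqxx.
case/and3P=> /andP[_ xe] _ Hw; rewrite inE => /predU1P[->|yw yn].
  by rewrite xe.
by rewrite (IH u) ?orbT.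
Qed.

(** As [u] lies in [e] but in no earlier edge, [e] is new; as every vertex of the walk except
    possibly its end lies on one of its edges, [u] is new too. *)
Lemma self_avoiding_rcons x w e u :
  self_avoiding E x (rcons w (e, u))
  = [&& self_avoiding E x w, e \in E, walk_end x w \in e, u \in e,
        u != walk_end x w & all (fun s : {set V} * V => u \notin s.1) w].
Proof.
rewrite /self_avoiding incidence_seq_rcons cat_uniq pairwise_rcons /=.
rewrite cat_path -/(sorted _ (incidence_seq x w)).
rewrite -[last _ _]/(last (inl x) (incidence_seq x w)) last_incidence_seq /=.
rewrite !inE /= !orbF -!/(incidence_seq x w).
have := mem_edge_incidence_seq x w e; rewrite inE /= => ->.
have := mem_incidence_seq x w u; rewrite !inE /= => ->.
rewrite !andbT -in_cons; apply/idP/idP.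
  case/and4P=> /and3P[-> /andP[-> ->] /= ->] /andP[-> /norP[_ Hu]] -> ->.
  by rewrite !andbT /=; apply: contra Hu => /eqP->; rewrite mem_last.
case/andP=> /and3P[Hp -> ->] /and5P[-> -> ue nu Hall].
rewrite Hp Hall ue /= andbT; apply/norP; split.
  by apply/mapP=> -[s sw es]; move/allP/(_ s sw): Hall; rewrite -es ue.
apply/negP=> uw; have /hasP[s sw us] := walk_vertex_in_edge Hp uw nu.
by move/allP/(_ s sw): Hall; rewrite us.
Qed.

Lemma self_avoiding_behead x e u w :
  self_avoiding E x ((e, u) :: w) -> self_avoiding E u w.
Proof.
by case/and3P=> /= /and3P[_ _ ?] /and3P[_ _ ?] /andP[_ ?]; apply/and3P.
Qed.

Lemma closes_cycle0 x w e : self_avoiding E x w -> (0 < size w)%N ->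
  closes_cycle E x w 0 e
  = [&& e \in E, x \in e, walk_end x w \in e & e \notin unzip1 w].
Proof.
case/and3P=> Hp Hu _ w0;
  rewrite /closes_cycle w0 drop0 -[walk_vertex x w 0]/x andTb.
rewrite /ucycleb rcons_uniq mem_edge_incidence_seq Hu andbT.
set p := incidence_seq x w; have -> : cycle (incidence E) (rcons p (inr e))
    = path (incidence E) (inl x) (rcons (rcons (behead p) (inr e)) (inl x)) by
      [].
rewrite !rcons_path last_rcons -/(sorted _ p).
have -> : last (inl x) (behead p) = inl (walk_end x w).
  exact: last_incidence_seq x w (inl x).
rewrite -[path _ _ _]/(sorted (incidence E) p) Hp /=.
by case: (e \in E); case: (x \in e); case: (_ \in e); rewrite ?andbF ?andbT.
Qed.

(* [violating] with an arbitrary starting point, to allow recursion on the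
   walk. *)
Definition violation x w : bool :=
  [exists e' : {set V}, [exists i : 'I_(size w),
     closes_cycle E x w i e'
     && ltE (walk_vertex x w i) e' (walk_edge w i)]].

Lemma violation_cons x f z w : self_avoiding E x ((f, z) :: w) ->
  violation x ((f, z) :: w)
  = [exists e in E, [&& x \in e, walk_end z w \in e, e \notin f :: unzip1 w
                      & ltE x e f]] || violation z w.
Proof.
move=> SA; have stepE (i : 'I_(size w)) e :
    closes_cycle E x ((f, z) :: w) i.+1 e
      && ltE (walk_vertex x ((f, z) :: w) i.+1) e (walk_edge ((f, z) :: w) i.+1)
    = closes_cycle E z w i e && ltE (walk_vertex z w i) e (walk_edge w i).
  (* The two sides differ only in the default value of [nth], and the index is in range. *)
  have vE : walk_vertex x ((f, z) :: w) i.+1 = walk_vertex z w i.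
    rewrite /walk_vertex /=; apply: set_nth_default.
    by rewrite /= size_map ltnS ltnW.
  by rewrite /closes_cycle vE.
apply/idP/orP.
  case/existsP=> e /existsP[[[|i] /= Hi]].
    rewrite closes_cycle0 // => /andP[/and4P[eE xe we new] lt].
    by left; apply/exists_inP; exists e => //; rewrite xe we new.
  rewrite (stepE (Ordinal (Hi : (i < size w)%N))) => H; right.
  by apply/existsP; exists e; apply/existsP;
    exists (Ordinal (Hi : (i < size w)%N)).
case=> [/exists_inP[e eE /and4P[xe we new lt]]|].
  apply/existsP; exists e; apply/existsP; exists ord0 => /=.
  by rewrite closes_cycle0 // eE xe we lt andbT.
case/existsP=> e /existsP[i H]; apply/existsP; exists e.
by apply/existsP; exists (lift ord0 i); rewrite lift0 stepE.
Qed.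

(* An edge [e'] preceding the first edge [f] at [x] and containing [u] closes a
   cycle at [u], unless [e'] is an edge of the walk. It is no edge of [w], as
   these do not contain [u]; and if it is [e], then [w] is already violating,
   since its end lies in [e]. *)
Lemma violation_rcons x w e u :
  self_avoiding E x (rcons w (e, u)) -> ~~ violation x w ->
  ~~ violation x (rcons w (e, u))
  = unblocked x w u && ~~ covered_before (walk_end x w) e u.
Proof.
elim: w x => [|[f z] w IH] x /=.
  move=> SA _; rewrite (violation_cons SA).
  have -> : violation u [::] = false.
    by apply/existsP=> -[e' /existsP[[]]].
  rewrite orbF; congr (~~ _); apply: eq_existsb => e'.
  case: (boolP (e' \in E)) => //= e'E; case: (boolP (x \in e')) => //= xe'.
  rewrite inE /walk_end /= [RHS]andbC; case: (u \in e') => //=.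
  (* [covered_before] does not ask for [e'] to be new; irreflexivity excludes the case [e' = e]. *)
  have [->|//] := eqVneq e' e.
  case: (ltE_order x) => irr _ _; rewrite irr //.
  by move: SA => /and3P[/and3P[/andP[eE xe] _ _] _ _]; rewrite inE eE.
move=> SA nv.
move: (SA); rewrite -rcons_cons self_avoiding_rcons.
case/and5P=> SAw _ we ue /andP[_ Hall].
move: (nv); rewrite (violation_cons SAw) negb_or => /andP[nv0 nvw].
have SAz := self_avoiding_behead SA.
rewrite (violation_cons SA) negb_or IH //.
have uf : u \notin f by case/andP: Hall.
rewrite uf /= -[walk_end x ((f, z) :: w)]/(walk_end z w) -andbA.
congr (_ && _); congr (~~ _); apply: eq_existsb => e'.
case: (boolP (e' \in E)) => //= e'E; case: (boolP (x \in e')) => //= xe'.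
rewrite /walk_end /unzip2 map_rcons last_rcons /=.
case: (boolP (u \in e')) => ue' /=; last by rewrite andbF.
rewrite andbT; case: (boolP (ltE x e' f)) => lt; rewrite ?andbF // andbT.
rewrite /unzip1 map_rcons inE mem_rcons inE !negb_or /=.
apply/and3P; split.
- by apply: contraNneq uf => <-.
- apply: contra nv0 => /eqP e'e; apply/exists_inP; exists e' => //.
  rewrite xe' lt e'e we /= andbT; move: SA; rewrite -rcons_cons => /and3P[_].
  rewrite incidence_seq_rcons cat_uniq => /and3P[_ /norP[+ _] _] _.
  by rewrite mem_edge_incidence_seq.
- apply/mapP=> -[s sw e's]; move/allP: Hall => /(_ s).
  by rewrite inE sw orbT -e's ue' => /(_ isT).
Qed.

End Extension.

(** * Comparison with the tree *)

Section TreeRecursion.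
Variables (V : finType) (E : {set {set V}}) (ltE : V -> rel {set V}) (v : V).
Hypothesis ltE_order : forall u : V,
  strict_total_order_on [set e in E | u \in e] (ltE u).
Local Notation node := (tree_node E ltE v).
Implicit Types (x y z : node) (e f : {set V}) (u : V).

Definition node_walk x : seq ({set V} * V) := saw_seq (val x).

Lemma node_walk_inj : injective node_walk.
Proof. by move=> x y /val_inj/val_inj/val_inj. Qed.

(** The only prefix of the longer walk that is not a prefix of [saw_seq w] is the longer walk
    itself. *)
Lemma deleted_rcons (w w' : saw E v) (s : {set V} * V) :
  saw_seq w' = rcons (saw_seq w) s ->
  deleted ltE w' = deleted ltE w || violation E ltE v (saw_seq w').
Proof.
move=> ww'; apply/existsP/orP => [[x /andP[]]|[/existsP[x /andP[xw vx]]|vw']].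
- rewrite ww' -cats1 => /prefixP[t]; case/lastP: t => [|t s'].
    by rewrite cats0 => xw vx; right; rewrite xw.
  rewrite -rcons_cat cats1 => /rcons_inj[xw _] vx; left.
  by apply/existsP; exists x; rewrite vx andbT xw prefix_prefix.
- exists x; rewrite vx andbT ww'.
  exact: prefix_trans xw (prefix_rcons _ _).
- by exists w'; rewrite prefix_refl.
Qed.

Lemma node_not_violation x : ~~ violation E ltE v (node_walk x).
Proof.
apply/negP=> vx; have /existsP := valP x; apply.
by exists (val x); rewrite prefix_refl.
Qed.

Definition extendable x e u : bool :=
  [&& e \in E, node_vertex x \in e, u \in e, u != node_vertex x,
      unblocked E ltE v (node_walk x) u
    & ~~ covered_before E ltE (node_vertex x) e u].

(** The link between hypergraph and tree: an unblocked vertex keeps the walk self-avoiding, and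
    [violation_rcons] identifies survival under the deletions with the absence of a new
    violation. *)
Lemma extendableP x e u :
  reflect (exists y, node_walk y = rcons (node_walk x) (e, u))
          (extendable x e u).
Proof.
apply: (iffP and5P) => [[eE xe ue ux /andP[ub cb]]|[y yx]].
  have SA : self_avoiding E v (rcons (node_walk x) (e, u)).
    rewrite self_avoiding_rcons eE xe ue ux (unblocked_edges ub) !andbT.
    exact: valP (val x).
  have sz : (size (rcons (node_walk x) (e, u)) <= #|V|)%N.
    exact/ltnW/self_avoiding_size/SA.
  pose w' : saw E v := Sub (Bseq sz : walk_type V) SA.
  have nd : ~~ deleted ltE w'.
    rewrite (@deleted_rcons (val x) w' (e, u)) // negb_or (valP x) /=.
    by rewrite (violation_rcons ltE_order) ?ub ?node_not_violation.
  by exists (Sub w' nd).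
have SA : self_avoiding E v (rcons (node_walk x) (e, u)).
  by rewrite -yx; exact: valP (val y).
have := SA; rewrite self_avoiding_rcons => /and5P[_ -> -> -> /andP[-> _]].
rewrite -(violation_rcons ltE_order SA) ?node_not_violation //.
by rewrite -yx node_not_violation.
Qed.

Lemma node_vertex_rcons x y e u :
  node_walk y = rcons (node_walk x) (e, u) -> node_vertex y = u.
Proof.
move=> yx; rewrite /node_vertex -/(node_walk y) yx /walk_end /unzip2.
by rewrite map_rcons last_rcons.
Qed.

(** It reduces to [[set x]], which is no hyperedge of the tree, when no child through [e] is
    kept. *)
Definition child_edge x e : {set node} :=
  [set y | val y \in val x |: saw_extensions (val x) e].

Lemma child_edgeP x e y :
  reflect (y = x \/ node_walk y = rcons (node_walk x) (e, node_vertex y))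
          (y \in child_edge x e).
Proof.
rewrite inE; apply: (iffP setU1P) => [[/val_inj->|]|[->|yx]]; try by left.
  by rewrite inE => /existsP[u /eqP yx]; right; rewrite (node_vertex_rcons yx).
by right; rewrite inE; apply/existsP; exists (node_vertex y); apply/eqP.
Qed.

Lemma mem_child_edge x y e u :
  node_walk y = rcons (node_walk x) (e, u) -> y \in child_edge x e.
Proof.
by move=> yx; apply/child_edgeP; right; rewrite (node_vertex_rcons yx).
Qed.

Lemma child_edge_tree x y e : y \in child_edge x e -> y != x ->
  child_edge x e \in tree_hyperedges E ltE v.
Proof.
move=> yC yx; rewrite inE; apply/andP; split; last first.
  apply/card_gt1P; exists x, y; rewrite yC eq_sym yx; split=> //.
  by apply/child_edgeP; left.
apply/imsetP; exists (val x |: saw_extensions (val x) e) => //.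
case/child_edgeP: yC yx => [->|yx _]; first by rewrite eqxx.
apply/imset2P; exists (val x) e; rewrite ?inE //.
have /and3P[-> _ _] : extendable x e (node_vertex y) by apply/extendableP;
  exists y.
apply/set0Pn; exists (val y); rewrite inE; apply/existsP.
by exists (node_vertex y); apply/eqP.
Qed.

Lemma child_edge_card x e :
  child_edge x e \in tree_hyperedges E ltE v \/ (#|child_edge x e| <= 1)%N.
Proof.
rewrite leqNgt; case: (boolP (1 < _)%N) => [/card_gt1P[y [z [yC zC yz]]]|];
  last by right.
left; have [yx|yx] := eqVneq y x; last exact: child_edge_tree yC yx.
by apply: child_edge_tree zC _; rewrite -yx eq_sym.
Qed.

Lemma tree_hyperedgeP (F : {set node}) :
  F \in tree_hyperedges E ltE v -> exists z e, F = child_edge z e.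
Proof.
rewrite inE => /andP[/imsetP[g /imset2P[w e _ eE ->] ->]] /card_gt1P[y [z [yf
  zf yz]]].
(* Deletion passes to descendants: if [w] were deleted, no node of its hyperedge would remain. *)
suff nd : ~~ deleted ltE w by exists (Sub w nd), e.
have key t : t \in [set t : node | val t \in w |: saw_extensions w e] ->
    deleted ltE w -> False.
  rewrite inE => /setU1P[<-|]; first exact/negP/(valP t).
  rewrite inE => /existsP[u /eqP tw] dw; have /negP := valP t; apply.
  by rewrite (deleted_rcons tw) dw.
exact/negP/(key y yf).
Qed.

(** The end of the walk is put back because, except at the root, it lies on the last edge taken and
    is blocked. *)
Definition active x : {set V} :=
  [set u | (u == node_vertex x) || unblocked E ltE v (node_walk x) u].

Lemma active_child x y e u : node_walk y = rcons (node_walk x) (e, u) ->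
  active y = [set t in active x | [&& t != node_vertex x,
     ~~ covered_before E ltE (node_vertex x) e t & (t \in e) ==> (t == u)]].
Proof.
move=> yx; have /and5P[eE xe ue ux /andP[ub cb]] : extendable x e u.
  by apply/extendableP; exists y.
apply/setP=> t; rewrite !inE (node_vertex_rcons yx) yx unblocked_rcons.
have [->|tu] /= := eqVneq t u; first by rewrite ub ux cb orbT implybT.
rewrite implybF; have [->|tx] /= := eqVneq t (node_vertex x).
  by rewrite xe /= andbF.
by rewrite [X in _ && X]andbC.
Qed.

Variables (R : realFieldType) (lambda : R) (L : {set V}) (sigma : V -> bool).
Hypothesis lambda_gt0 : 0 < lambda.
Hypothesis pinned_independent : independent E [set u in L | sigma u].
Let LT : {set node} := [set x | node_vertex x \in L].
Let sigmaT (x : node) := sigma (node_vertex x).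
Hypothesis pinned_independentT :
  independent (tree_hyperedges E ltE v) [set x in LT | sigmaT x].

Local Notation oddsH := (odds E lambda L sigma).
Local Notation oddsT := (odds (tree_hyperedges E ltE v) lambda LT sigmaT).
Local Notation edge_factorsH := (edge_factors E lambda L sigma).
Local Notation edge_factorsT :=
  (edge_factors (tree_hyperedges E ltE v) lambda LT sigmaT).

(* [A] may contain nodes outside the branch at [x], but then none on the parent
   edge of [x]. *)
Definition isolates (A : {set node}) x : Prop :=
  (forall y, prefix (node_walk x) (node_walk y) -> y \in A)
  /\ (forall z e u y, node_walk x = rcons (node_walk z) (e, u) ->
        y \in A -> y \in child_edge z e -> y = x).

Lemma mem_cover_seq (T : finType) (s : seq {set T}) (t : T) :
  (t \in cover_seq s) = has (fun e : {set T} => t \in e) s.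
Proof.
rewrite /cover_seq; elim: s => [|e s IH] /=; first by rewrite big_nil inE.
by rewrite big_cons inE IH.
Qed.

Lemma cover_seq_rcons (T : finType) (s : seq {set T}) (e : {set T}) :
  cover_seq (rcons s e) = cover_seq s :|: e.
Proof.
by apply/setP=> t; rewrite in_setU !mem_cover_seq has_rcons orbC.
Qed.

Lemma pinned_node y : pinned LT sigmaT y = pinned L sigma (node_vertex y).
Proof. by rewrite /pinned inE. Qed.

(** Both odds obey [odds_rec] along the same ordered list of edges at the end of [x]. The induction
    goes through longer walks, whose length stays below [#|V|]. *)
Lemma odds_tree x (A : {set node}) :
  isolates A x -> ~~ pinned L sigma (node_vertex x) ->
  oddsH (active x) (node_vertex x) = oddsT A x.
Proof.
have [n] := ubnP (#|V| - size (node_walk x)).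
elim: n => // n IH in x A *; rewrite ltnS => xn [HA1 HA2] nx.
have xA : x \in A by apply: HA1; exact: prefix_refl.
have xa : node_vertex x \in active x by rewrite inE eqxx.
have [xL|xL] := boolP (node_vertex x \in L).
  have sx : ~~ sigma (node_vertex x) by move: nx; rewrite /pinned xL.
  by rewrite !odds_pinned0 // inE.
have [s sE ss] := pairwise_enumeration (ltE_order (node_vertex x)).
have [irr tr _] := ltE_order (node_vertex x).
have sD e : (e \in s) = (e \in E) && (node_vertex x \in e) by rewrite sE inE.
rewrite (odds_rec lambda_gt0 pinned_independent xa xL (s := s)); first last.
- move=> u _ _; rewrite mem_cover_seq; apply/hasP/exists_inP => -[e].
    by rewrite sD => /andP[eE xe] ue; exists e; rewrite ?ue.
  by move=> eE /andP[ue xe]; exists e; rewrite // sD eE.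
- by move=> e; rewrite sD => /andP[]; left.
rewrite (odds_rec lambda_gt0 pinned_independentT xA _
  (s := [seq child_edge x e | e <- s])) ?inE //; first last.
- move=> y yA yx; rewrite mem_cover_seq has_map; apply/hasP/exists_inP => -[].
    move=> e es /= yC; exists (child_edge x e);
      first exact: child_edge_tree yC yx.
    by rewrite yC; apply/child_edgeP; left.
  (* An edge through [x] is a child edge or the parent edge of [x]; on the latter, isolation leaves
     no active node but [x]. *)
  move=> f fT /andP[yf xf]; have [z [e fz]] := tree_hyperedgeP fT; subst f.
  case/child_edgeP: xf => [zx|xz].
    subst z; exists e => //; case/child_edgeP: (yf) => [/eqP|yx'].
      by rewrite (negbTE yx).
    have : extendable x e (node_vertex y) by apply/extendableP; exists y.
    by rewrite sD => /and3P[-> ->].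
  by move: yx; rewrite (HA2 _ _ _ _ xz yA yf) eqxx.
- by move=> f /mapP[e _ ->]; exact: child_edge_card.
congr (_ * _).
(* [s1] holds the edges already revealed, whose union both active sets have lost. *)
suff H s1 s2 : s = s1 ++ s2 ->
    edge_factorsH (active x :\ node_vertex x :\: cover_seq s1) s2
    = edge_factorsT (A :\ x :\: cover_seq [seq child_edge x e | e <- s1])
        [seq child_edge x e | e <- s2].
  by have := H [::] s erefl; rewrite /cover_seq !big_nil !setD0.
elim: s2 s1 => //= e s2 IHs s1 Ds.
have es : e \in s by rewrite Ds mem_cat mem_head orbT.
have /andP[eE xe] : (e \in E) && (node_vertex x \in e) by rewrite -sD.
(* Since [s] is sorted, the edges already revealed are those that [covered_before] refers to. *)
have s1E e' : (e' \in s1) = [&& e' \in E,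
  node_vertex x \in e' & ltE (node_vertex x) e' e].
  have memD f : f \in s -> f \in [set e in E | node_vertex x \in e]
    by rewrite sE.
  move: (ss); rewrite Ds pairwise_cat =>
    /and3P[/allrelP s12 _ /= /andP[/allP es2 _]].
  rewrite andbA -sD; apply/idP/andP => [e's|[]].
    by rewrite Ds mem_cat e's; split=> //; apply: s12; rewrite ?mem_head.
  move=> e's lt; move: (e's); rewrite Ds mem_cat => /orP[//|].
  rewrite inE => /predU1P[ee|/es2 lt'].
    by move: lt; rewrite ee irr ?memD.
  have := tr e' e e (memD _ e's) (memD _ es) (memD _ es) lt' lt.
  by rewrite irr ?memD.
have cover1 u : (u \in cover_seq s1) = covered_before E ltE (node_vertex x) e u.
  rewrite mem_cover_seq; apply/hasP/exists_inP => -[e'].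
    by rewrite s1E => /and3P[e'E xe' lt] ue'; exists e'; rewrite ?xe' ?lt.
  by move=> e'E /and3P[xe' lt ue']; exists e'; rewrite // s1E e'E xe'.
have es1 : e \notin s1 by rewrite s1E irr ?andbF // -sE.
have step (T : finType) (B : {set T}) (t : seq {set T}) g :
    B :\: cover_seq t :\: g = B :\: cover_seq (rcons t g).
  by rewrite cover_seq_rcons setDDl.
rewrite !step -map_rcons -IHs ?cat_rcons //; congr (_ * _).
set UH := _ :\: _; set UT := A :\ x :\: _.
(* A branch entered through [e] meets no child edge already revealed, as [e] is not in [s1]; so it
   is still intact. *)
have belowUT y z u : node_walk y = rcons (node_walk x) (e, u) ->
    prefix (node_walk y) (node_walk z) -> z \in UT.
  move=> yx yz; have xz : prefix (node_walk x) (node_walk z).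
    by apply: prefix_trans yz; rewrite yx prefix_rcons.
  have zx : z != x.
    apply: contraTneq (size_prefix yz) => ->.
    by rewrite yx size_rcons ltnn.
  rewrite !inE mem_cover_seq has_map zx HA1 // !andbT;
    apply/hasP=> -[e' e's] /=.
  case/child_edgeP=> [/eqP|zx']; first by rewrite (negbTE zx).
  move: yz; rewrite yx zx' prefixE size_rcons -(size_rcons (node_walk x) (e',
    node_vertex z)).
  by rewrite take_size => /eqP/rcons_inj[ee' _]; move: es1; rewrite -ee' e's.
have childP y : reflect (exists u, node_walk y = rcons (node_walk x) (e, u))
    (y \in child_edge x e :&: UT).
  apply: (iffP setIP) => [[/child_edgeP[->|yx]]|[u yx]].
  - by rewrite !inE eqxx andbF.
  - by exists (node_vertex y).
  - split; first exact: mem_child_edge yx.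
    exact: belowUT yx (prefix_refl _).
(* By [extendableP], what remains of [e] consists of the ends of the kept children through [e]; with
   [injD], the two sums then match term by term. *)
have DE : e :&: UH = [set node_vertex y | y in child_edge x e :&: UT].
  apply/setP=> u; apply/idP/imsetP => [|[y /childP[u' yx]->]].
    rewrite !inE cover1 => /and4P[ue cb ux].
    rewrite (negbTE ux) /= => ub.
    have /extendableP[y yx] : extendable x e u by apply/and5P; rewrite ub cb.
    by exists y; rewrite ?(node_vertex_rcons yx) //; apply/childP; exists u.
  have /and5P[_ _ ue ux /andP[ub cb]] : extendable x e u'
    by apply/extendableP; exists y.
  by rewrite (node_vertex_rcons yx) !inE cover1 ue ux cb ub orbT.
have injD : {in child_edge x e :&: UT &, injective (@node_vertex V E ltE v)}.
  move=> y z /childP[u yx] /childP[u' zx] yz; apply: node_walk_inj.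
  by rewrite yx zx -(node_vertex_rcons yx) -(node_vertex_rcons zx) yz.
rewrite /edge_factor DE.
have -> : [exists u in [set node_vertex y |
  y in child_edge x e :&: UT], pinned L sigma u]
   = [exists y in child_edge x e :&: UT, pinned LT sigmaT y].
  apply/exists_inP/exists_inP => [[_ /imsetP[y yC ->] py]|[y yC py]].
    by exists y; rewrite ?pinned_node.
  by exists (node_vertex y); [exact: imset_f|rewrite -pinned_node].
case: ifPn => // np; congr (_ ^-1); congr (1 + _); rewrite big_imset //=.
apply: eq_bigr => y yC; have /childP[u yx] := yC.
have Eu := node_vertex_rcons yx.
have -> : UH :\: (e :\ node_vertex y) = active y.
  apply/setP=> t; rewrite (active_child yx) !inE cover1 Eu.
  by case: (t == u); case: (t \in e); case: covered_before;
    case: (t == node_vertex x); case: unblocked.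
apply: IH; last 2 first.
(* The child [y] is isolated in turn: the other nodes of its parent edge, [x] and the siblings
   through [e], are now deleted, and none of them lies below [y]. *)
- split=> [z yz|z e' u' t yz].
    rewrite in_setD in_setD1 (belowUT _ _ _ yx yz) andbT negb_and negbK.
    have [//|zy] := eqVneq z y; apply/child_edgeP=> -[zx|zx].
      by move: (size_prefix yz); rewrite zx yx size_rcons ltnn.
    case/negP: zy; apply/eqP/node_walk_inj; move: yz.
    by rewrite prefixE yx zx size_rcons -(size_rcons (node_walk x) (e,
      node_vertex z)) take_size => /eqP.
  move: yz; rewrite yx => /rcons_inj[/node_walk_inj <- <- _].
  by rewrite !inE => /andP[+ _] tC; rewrite tC andbT negbK => /eqP.
- apply: contra np => py; apply/exists_inP; exists y => //;
  exact: etrans (pinned_node y) py.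
- apply: leq_trans _ xn; rewrite yx size_rcons ltn_sub2l //.
  exact: self_avoiding_size (valP (val x)).
Qed.

Lemma isolates_root : isolates [set: node] (tree_root E ltE v).
Proof.
split=> [y _|z e u y /(congr1 size)]; first exact: in_setT.
by rewrite size_rcons.
Qed.

Lemma active_root : active (tree_root E ltE v) = [set: V].
Proof. by apply/setP=> u; rewrite !inE orbT. Qed.

End TreeRecursion.

Theorem theorem14 (R : realFieldType) (V : finType) (E : {set {set V}})
    (lambda : R) (ltE : V -> rel {set V}) (v : V)
    (L : {set V}) (sigma : V -> bool)
    (lambda_gt0 : 0 < lambda)
    (ltE_order : forall u : V,
       strict_total_order_on [set e in E | u \in e] (ltE u))
    (sigma_feasible : 0 < Pr E lambda (agrees L sigma)) :
  marginal E lambda L sigma v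
  = marginal (tree_hyperedges E ltE v) lambda
      [set x : tree_node E ltE v | node_vertex x \in L]
      (fun x : tree_node E ltE v => sigma (node_vertex x))
      (tree_root E ltE v).
Proof.
have tree_feasible := tree_Pr_agrees_gt0 ltE v lambda_gt0 sigma_feasible.
rewrite Pr_agrees_gt0 // in sigma_feasible.
rewrite Pr_agrees_gt0 // in tree_feasible.
rewrite !marginal_odds // pinned_node.
have -> : node_vertex (tree_root E ltE v) = v by [].
(* If [v] is pinned, both marginals are 1. Otherwise the odds are compared at the root, where
   nothing has been deleted yet. *)
case: ifPn => // nv; rewrite -(active_root E ltE v).
by rewrite -(odds_tree ltE_order lambda_gt0 sigma_feasible tree_feasible
  (isolates_root E ltE v)).
Qed.
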